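(* Let $c_1,c_2\in\mathbb{R}^d$ be two distinct fixed centers, let $X=(x_1,\dots,x_n)\in(\mathbb{R}^d)^n$, and let $\gamma_{\min}=\min_{1\le i\le n}\gamma_i$, where $\gamma_i=\bigl|\,\|x_i-c_1\|-\|x_i-c_2\|\,\bigr|$. Let $X'=(x_1',\dots,x_n')\in(\mathbb{R}^d)^n$ satisfy $\|X-X'\|\le\varepsilon$. If $\varepsilon<\gamma_{\min}/2$, then no point changes its assigned center under the perturbation (that is, for every $i$ the center assigned to $x_i'$ is the center assigned to $x_i$), and consequently $A(X')=A(X)$.
   Context: Here $n\ge 2$, $[n]=\{1,\dots,n\}$, and $\|\cdot\|$ on $\mathbb{R}^d$ is the Euclidean norm. A labeled point configuration is an ordered $n$-tuple $X=(x_1,\dots,x_n)\in(\mathbb{R}^d)^n$, and $\|X-X'\|=\max_{1\le i\le n}\|x_i-x_i'\|$. Nearest-center assignment with two fixed centers: a point $x\in\mathbb{R}^d$ is assigned to $c_1$ if $\|x-c_1\|\le\|x-c_2\|$, and to $c_2$ otherwise (so ties go to $c_1$). The same centers are used for $X$ and $X'$. The induced partition $A(X)$ of $[n]$ is the one in which $i,j$ lie in the same block if and only if $x_i$ and $x_j$ are assigned to the same center. *)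

(* Defs.v *)
From mathcomp Require Import all_boot all_order all_algebra.
From mathcomp Require Import reals.

Set Implicit Arguments.
Unset Strict Implicit.
Unset Printing Implicit Defensive.

Import Order.TTheory GRing.Theory Num.Theory.
Local Open Scope ring_scope.

(* MathComp-Analysis equips ['rV[R]_d] with the sup norm, and the dot product
   of [spectral] is only available over a [numClosedFieldType]; hence this
   explicit Euclidean norm. *)
Definition enorm (R : realType) (d : nat) (x : 'rV[R]_d) : R :=
  Num.sqrt (\sum_(j < d) x ord0 j ^+ 2).

Definition config (R : realType) (d n : nat) := 'I_n -> 'rV[R]_d.

(* The default value 0 does not alter the maximum, since norms are
   nonnegative. *)
Definition config_dist (R : realType) (d n : nat) (X X' : config R d n) : R :=
  \big[Num.max/0]_(i < n) enorm (X i - X' i).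

(* The value is the center itself, not a label; ties go to [c1]. *)
Definition assigned_center (R : realType) (d : nat) (c1 c2 x : 'rV[R]_d) :
    'rV[R]_d :=
  if enorm (x - c1) <= enorm (x - c2) then c1 else c2.

(* Two indices lie in the same block iff their points are assigned to the same
   center (see [pblock_equivalence_partition]); empty blocks do not occur. *)
Definition induced_partition (R : realType) (d n : nat) (c1 c2 : 'rV[R]_d)
    (X : config R d n) : {set {set 'I_n}} :=
  preim_partition (fun i => assigned_center c1 c2 (X i)) [set: 'I_n].

Definition margin (R : realType) (d : nat) (c1 c2 x : 'rV[R]_d) : R :=
  `|enorm (x - c1) - enorm (x - c2)|.

(* [Num.min] has no neutral element in [R], so the iteration starts from the
   margin of the first point, which exists since [0 < n]. *)
Definition min_margin (R : realType) (d n : nat) (n_gt0 : (0 < n)%N)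
    (c1 c2 : 'rV[R]_d) (X : config R d n) : R :=
  \big[Num.min/margin c1 c2 (X (Ordinal n_gt0))]_(i < n) margin c1 c2 (X i).

(* Main.v *)
Require Import Defs.
From mathcomp Require Import all_boot all_order all_algebra.
From mathcomp Require Import reals.
From mathcomp Require Import ring lra.

Import Order.TTheory GRing.Theory Num.Theory.
Local Open Scope ring_scope.

(** The sign of the gap [enorm (x - c1) - enorm (x - c2)] decides to which
    center [x] is assigned, and the margin of [x] is the absolute value of that
    gap.  By the triangle inequality each of the two distances moves by at most
    [eps] when [x] does, so the gap moves by at most [2 * eps]
    ([assigned_center_stable]).  A margin exceeding [2 * eps] therefore keeps
    the gap away from zero on the same side, and no tie can appear.  The
    partition only depends on the assignment map, so it is unchanged as well.

    The analytic input is the triangle inequality for [enorm] ([enormD]),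
    obtained from the Cauchy-Schwarz inequality [dot_le_enorm]. *)

Lemma enorm_ge0 (R : realType) (d : nat) (x : 'rV[R]_d) : 0 <= enorm x.
Proof. exact: sqrtr_ge0. Qed.

Lemma sqr_enorm (R : realType) (d : nat) (x : 'rV[R]_d) :
  enorm x ^+ 2 = \sum_(j < d) x ord0 j ^+ 2.
Proof. by rewrite sqr_sqrtr // sumr_ge0 // => j _; apply: sqr_ge0. Qed.

Lemma enorm_eq0 (R : realType) (d : nat) (x : 'rV[R]_d) :
  enorm x = 0 -> x = 0.
Proof.
move=> x0; apply/rowP => j; rewrite mxE; apply/eqP; rewrite -sqrf_eq0.
have /eqP : \sum_(j < d) x ord0 j ^+ 2 = 0 by rewrite -sqr_enorm x0 expr0n.
rewrite psumr_eq0 => [/allP /(_ j)|k _]; last exact: sqr_ge0.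
by rewrite mem_index_enum; apply.
Qed.

Lemma enormN (R : realType) (d : nat) (x : 'rV[R]_d) : enorm (- x) = enorm x.
Proof.
by congr Num.sqrt; apply: eq_bigr => j _; rewrite mxE sqrrN.
Qed.

(** Cauchy-Schwarz: with [a := enorm x] and [b := enorm y], the squared norm of
    [b *: x - a *: y] equals [2 * (a * b) * (a * b - <x, y>)], which settles the
    case [0 < a * b]; otherwise one of the vectors vanishes. *)
Lemma dot_le_enorm (R : realType) (d : nat) (x y : 'rV[R]_d) :
  \sum_(j < d) x ord0 j * y ord0 j <= enorm x * enorm y.
Proof.
have [ab0|ab_neq0] := eqVneq (enorm x * enorm y) 0.
  rewrite ab0 big1 // => j _; move/eqP: ab0; rewrite mulf_eq0.
  by case/orP => /eqP/enorm_eq0 ->; rewrite mxE ?mul0r ?mulr0.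
have ab_gt0 : 0 < enorm x * enorm y.
  by rewrite lt_neqAle eq_sym ab_neq0 mulr_ge0 // enorm_ge0.
have : 0 <= \sum_(j < d) (enorm y * x ord0 j - enorm x * y ord0 j) ^+ 2.
  by apply: sumr_ge0 => j _; apply: sqr_ge0.
have -> : \sum_(j < d) (enorm y * x ord0 j - enorm x * y ord0 j) ^+ 2 =
    2 * (enorm x * enorm y) *
      (enorm x * enorm y - \sum_(j < d) x ord0 j * y ord0 j).
  transitivity (enorm y ^+ 2 * (\sum_(j < d) x ord0 j ^+ 2)
     + enorm x ^+ 2 * (\sum_(j < d) y ord0 j ^+ 2)
     - 2 * (enorm x * enorm y) * \sum_(j < d) x ord0 j * y ord0 j).
    rewrite !mulr_sumr -big_split -sumrB /=.
    by apply: eq_bigr => j _; ring.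
  by rewrite -!sqr_enorm; ring.
by rewrite pmulr_rge0 ?subr_ge0 // mulr_gt0 // ltr0n.
Qed.

Lemma enormD (R : realType) (d : nat) (x y : 'rV[R]_d) :
  enorm (x + y) <= enorm x + enorm y.
Proof.
rewrite -(ler_pXn2r (n := 2)) ?nnegrE ?addr_ge0 ?enorm_ge0 //.
have -> : enorm (x + y) ^+ 2 = enorm x ^+ 2 + enorm y ^+ 2
    + 2 * \sum_(j < d) x ord0 j * y ord0 j.
  rewrite !sqr_enorm mulr_sumr -!big_split /=.
  by apply: eq_bigr => j _; rewrite mxE; ring.
by have := dot_le_enorm _ _ x y; lra.
Qed.

Lemma enorm_dist_lipschitz (R : realType) (d : nat) (x y c : 'rV[R]_d) :
  `|enorm (x - c) - enorm (y - c)| <= enorm (x - y).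
Proof.
have xE : x - c = (x - y) + (y - c) by rewrite addrA subrK.
have yE : y - c = - (x - y) + (x - c) by rewrite opprB addrA subrK.
have := enormD _ _ (x - y) (y - c); rewrite -xE => le_x.
have := enormD _ _ (- (x - y)) (x - c); rewrite -yE enormN => le_y.
by rewrite ler_norml; apply/andP; split; lra.
Qed.

(** The strict inequality is what protects against ties: were the gap of [x]
    allowed to be [2 * eps], that of [x'] could be [0], which sends [x'] to
    [c1] even though [x] goes to [c2]. *)
Lemma assigned_center_stable (R : realType) (d : nat)
    (c1 c2 x x' : 'rV[R]_d) (eps : R) :
  enorm (x - x') <= eps -> 2 * eps < margin c1 c2 x ->
  assigned_center c1 c2 x' = assigned_center c1 c2 x.
Proof.
rewrite /margin /assigned_center => xx' gap.
have := enorm_dist_lipschitz _ _ x x' c1; rewrite ler_norml => /andP[l1 u1].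
have := enorm_dist_lipschitz _ _ x x' c2; rewrite ler_norml => /andP[l2 u2].
(* [lerP] also resolves the absolute value in the margin. *)
case: (lerP (enorm (x - c1)) (enorm (x - c2))) gap => [le12|lt21] gap.
  by rewrite ifT //; lra.
by rewrite ifF //; apply/negbTE; rewrite -ltNge; lra.
Qed.

Lemma enorm_le_config_dist (R : realType) (d n : nat) (X X' : config R d n)
    (i : 'I_n) :
  enorm (X i - X' i) <= config_dist X X'.
Proof. exact: (le_bigmax _ (fun i => enorm (X i - X' i))). Qed.

Lemma min_margin_le (R : realType) (d n : nat) (n_gt0 : (0 < n)%N)
    (c1 c2 : 'rV[R]_d) (X : config R d n) (i : 'I_n) :
  min_margin n_gt0 c1 c2 X <= margin c1 c2 (X i).
Proof. exact: (bigmin_le _ i (fun i => margin c1 c2 (X i))). Qed.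

Lemma eq_induced_partition (R : realType) (d n : nat) (c1 c2 : 'rV[R]_d)
    (X X' : config R d n) :
  (forall i, assigned_center c1 c2 (X' i) = assigned_center c1 c2 (X i)) ->
  induced_partition c1 c2 X' = induced_partition c1 c2 X.
Proof.
move=> same; rewrite /induced_partition /preim_partition.
apply: eq_imset => i; apply/setP => j.
by rewrite !inE /= !same.
Qed.

Theorem theorem4p2 (R : realType) (d n : nat) (n_gt1 : (1 < n)%N)
    (c1 c2 : 'rV[R]_d) (c1_neq_c2 : c1 <> c2)
    (X X' : config R d n) (eps : R)
    (XX'_le_eps : config_dist X X' <= eps)
    (eps_lt_gamma : eps < min_margin (ltnW n_gt1) c1 c2 X / 2%:R) :
  (forall i : 'I_n, assigned_center c1 c2 (X' i) = assigned_center c1 c2 (X i))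
  /\ induced_partition c1 c2 X' = induced_partition c1 c2 X.
Proof.
have same i : assigned_center c1 c2 (X' i) = assigned_center c1 c2 (X i).
  apply: (assigned_center_stable _ _ _ _ _ _ eps).
    exact: le_trans (enorm_le_config_dist _ _ _ X X' i) XX'_le_eps.
  by have := min_margin_le _ _ _ (ltnW n_gt1) c1 c2 X i; lra.
by split=> //; apply: eq_induced_partition.
Qed.
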